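(* Let $X_1,\dots,X_{n}$ be Banach spaces such that $X_1,\dots,X_{n-1}$ are Asplund spaces, and let $G \subset X:= X_1 \times \cdots \times X_n$ be an open set. Let $f$ be a continuous (resp. Lipschitz) real function on $G$. Then there exists a first category (resp. $\sigma$-porous) set $A \subset G$ such that, for each $x \in G \setminus A$, the following implication holds: if $f$ has all Fréchet partial derivatives $f'_1(x),\dots,f'_n(x)$ at $x$, then $f$ is Fréchet differentiable at $x$.
   Context: All Banach spaces are real and nontrivial ($\neq\{0\}$), with norm denoted $|\cdot|$. $X_1\times\cdots\times X_n$ is equipped with the maximum norm. $B(x,r)$ is the open ball. A Banach space $X$ is an Asplund space if each continuous convex function on $X$ is Fréchet differentiable at all points except those of a first category set; equivalently, $Y^*$ is separable for each separable closed subspace $Y\subset X$. For $x=(x_1,\dots,x_n)\in G$, the partial Fréchet derivative $f'_i(x)\in X_i^*$ is (if it exists) the Fréchet derivative at $x_i$ of the function $t\mapsto f(x_1,\dots,x_{i-1},t,x_{i+1},\dots,x_n)$, defined for those $t\in X_i$ for which the argument lies in $G$. A first category (meagre) set is a countable union of nowhere dense sets. A set $A\subset X$ is porous at $x\in X$ if there exists $c>0$ such that for each $\delta>0$ there exists $t\in B(x,\delta)\setminus\{x\}$ with $B(t,c|t-x|)\cap A=\emptyset$. $A$ is porous if it is porous at each of its points, and $\sigma$-porous if it is a countable union of porous sets. *)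

(* Defs.v *)
From HB Require Import structures.
From mathcomp Require Import all_boot all_order all_algebra.
From mathcomp Require Import all_classical all_reals all_analysis.

Set Implicit Arguments.
Unset Strict Implicit.
Unset Printing Implicit Defensive.

Import Order.TTheory GRing.Theory Num.Theory.
Import numFieldNormedType.Exports.

Local Open Scope classical_set_scope.
Local Open Scope ring_scope.

(* X_0 x ... x X_(n-1) with the maximum norm. The library norms only binary
   products and matrices, not the product of a family of distinct spaces; its
   [prod_topology] carries a pseudometric that is not this norm's. *)
Definition maxprod (R : realType) (n : nat) (X : 'I_n -> normedModType R) :
  Type := forall i, X i.

Section MaxProd.
Context (R : realType) (n : nat) (X : 'I_n -> normedModType R).
Local Notation P := (maxprod X).
Implicit Types x y z : P.

HB.instance Definition _ := gen_eqMixin P.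
HB.instance Definition _ := gen_choiceMixin P.

Definition maxprod_zero : P := fun i => 0.
Definition maxprod_opp x : P := fun i => - x i.
Definition maxprod_add x y : P := fun i => x i + y i.
Definition maxprod_scale (a : R) x : P := fun i => a *: x i.

Let addA : associative maxprod_add.
Proof. by move=> x y z; apply: functional_extensionality_dep => i; exact: addrA. Qed.

Let addC : commutative maxprod_add.
Proof. by move=> x y; apply: functional_extensionality_dep => i; exact: addrC. Qed.

Let add0 : left_id maxprod_zero maxprod_add.
Proof. by move=> x; apply: functional_extensionality_dep => i; exact: add0r. Qed.

Let addN : left_inverse maxprod_zero maxprod_opp maxprod_add.
Proof. by move=> x; apply: functional_extensionality_dep => i; exact: addNr. Qed.

HB.instance Definition _ := GRing.isZmodule.Build P addA addC add0 addN.

Let scaleA a b x : maxprod_scale a (maxprod_scale b x) = maxprod_scale (a * b) x.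
Proof. by apply: functional_extensionality_dep => i; exact: scalerA. Qed.

Let scale1 : left_id 1 maxprod_scale.
Proof. by move=> x; apply: functional_extensionality_dep => i; exact: scale1r. Qed.

Let scaleDr : right_distributive maxprod_scale +%R.
Proof. by move=> a x y; apply: functional_extensionality_dep => i; exact: scalerDr. Qed.

Let scaleDl x : {morph maxprod_scale^~ x : a b / a + b}.
Proof. by move=> a b; apply: functional_extensionality_dep => i; exact: scalerDl. Qed.

HB.instance Definition _ :=
  GRing.Zmodule_isLmodule.Build R P scaleA scale1 scaleDr scaleDl.

Definition maxprod_norm x : R := \big[Num.max/0]_i `|x i|.

Let normD x y : maxprod_norm (x + y) <= maxprod_norm x + maxprod_norm y.
Proof.
apply/bigmax_leP; split=> [|i _]; first by rewrite addr_ge0// bigmax_ge_id.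
rewrite (le_trans (ler_normD _ _))// lerD//.
  exact: (le_bigmax _ (fun j => `|x j|)).
exact: (le_bigmax _ (fun j => `|y j|)).
Qed.

Let normZ a x : maxprod_norm (a *: x) = `|a| * maxprod_norm x.
Proof.
rewrite /maxprod_norm (eq_bigr (fun i => `|a| * `|x i|)) => [|i _]; last first.
  exact: normrZ.
by elim/big_ind2 : _ => [|b c d e -> ->|//]; rewrite ?mulr0// maxr_pMr.
Qed.

Let norm_eq0 x : maxprod_norm x = 0 -> x = 0.
Proof.
move=> x0; apply: functional_extensionality_dep => i; apply/eqP.
rewrite -normr_le0 -x0; exact: (le_bigmax _ (fun j => `|x j|)).
Qed.

HB.instance Definition _ :=
  Lmodule_isNormed.Build R P normD normZ norm_eq0.

End MaxProd.

Section SmallSets.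

Definition nowhere_dense (T : topologicalType) (A : set T) : Prop :=
  (closure A)^° = set0.

Definition first_category (T : topologicalType) (A : set T) : Prop :=
  exists2 F : nat -> set T,
    (forall k, nowhere_dense (F k)) & A = \bigcup_k F k.

Context (R : realType) (V : normedModType R).

Definition porous_at (A : set V) (x : V) : Prop :=
  exists2 c : R, 0 < c & forall delta : R, 0 < delta ->
    exists t : V, [/\ ball x delta t, t != x
                    & ball t (c * `|t - x|) `&` A = set0].

Definition porous (A : set V) : Prop := forall x, A x -> porous_at A x.

Definition sigma_porous (A : set V) : Prop :=
  exists2 F : nat -> set V, (forall k, porous (F k)) & A = \bigcup_k F k.

End SmallSets.

Definition asplund (R : realType) (V : completeNormedModType R) : Prop :=
  forall g : V -> R, continuous g -> convex_function setT g ->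
    first_category [set x | ~ differentiable g x].

(* [eqtype.dfwith x t] is [x] with its [i]-th coordinate replaced by [t]. When
   [x] is interior to a set G, this (like [differentiable f x]) depends only on
   the values of [f] on G, so that a function on an open G can be represented by
   any total extension of it. *)
Definition partial_differentiable (R : realType) (n : nat)
    (X : 'I_n -> normedModType R) (f : maxprod X -> R) (x : maxprod X)
    (i : 'I_n) : Prop :=
  differentiable (fun t : X i => f (eqtype.dfwith x t)) (x i).

(* Main.v *)
(* Fix a coordinate i and call J its isometric injection into the product. At a
   point x where the i-th partial derivative p exists, the increment of f along
   J t is p t up to e|t| for |t| < 1/m, for some m. It suffices to remove small
   sets of points so that, for every i < n, this approximation persists at all z
   near x up to e(|t| + |z - x|): the increment of f then telescopes along the
   coordinates, the last one being changed first, starting from x itself.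

   For Lipschitz f, remove the points at which the set of points admitting
   e-slopes up to radius 1/m is porous. Otherwise every z near x has a
   neighbour a in this set with |a - z| much smaller than |z - x|; the slope at
   a is close to p, by comparing increments on a sphere of radius 1/(2m), and it
   transfers to z.

   For continuous f, remove the points of these sets near which no single
   functional is a 4e-slope. If the removed set were dense in a ball, f would be
   uniformly Lipschitz along J there, and the supremum g of its difference
   quotients along J u would be a continuous sublinear function of u. As X_i is
   Asplund, g is Frechet differentiable at some u, and its derivative q there is
   an approximate slope of f at all points near the end of a segment on which g
   u is nearly attained: a contradiction. *)
Require Import Defs.
From HB Require Import structures.
From mathcomp Require Import all_boot all_order all_algebra.
From mathcomp Require Import all_classical all_reals all_analysis.
From mathcomp Require Import ring lra.

Set Implicit Arguments.
Unset Strict Implicit.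
Unset Printing Implicit Defensive.

Import Order.TTheory GRing.Theory Num.Theory.
Import numFieldNormedType.Exports.

Local Open Scope classical_set_scope.
Local Open Scope ring_scope.

(** * Approximate slopes, their comparison and their passage to limits *)

Definition approx_slope (R : realType) (E V : normedModType R) (J : E -> V)
    (f : V -> R) (p : E -> R) (e r : R) (z : V) : Prop :=
  forall h, `|h| < r -> `|f (z + J h) - f z - p h| <= e * `|h|.

Section Slopes.
Context (R : realType) (E V : normedModType R) (J : E -> V) (f : V -> R).
Implicit Types (p q : {linear E -> R}).

(** Homogeneity carries the bound from one sphere to every vector, and applying it to [- k] turns
    the one-sided bound into a two-sided one. *)
Lemma linear_le_of_sphere p q (c s : R) : 0 < s ->
  (forall k, `|k| = s -> p k <= q k + c * `|k|) ->
  forall k, `|p k - q k| <= c * `|k|.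
Proof.
move=> s0 H k; have [->|k0] := eqVneq k 0.
  by rewrite !linear0 addr0 !normr0 mulr0.
have nk : 0 < `|k| by rewrite normr_gt0.
pose a := s / `|k|.
have a0 : 0 < a by rewrite divr_gt0.
have na : `|a *: k| = s by rewrite normrZ gtr0_norm// divfK ?gt_eqF.
have pE (l : {linear E -> R}) : l (a *: k) = a * l k by rewrite linearZ.
have pN (l : {linear E -> R}) : l (- (a *: k)) = - (a * l k).
  by rewrite linearN pE.
have := H (- (a *: k)); have := H _ na.
rewrite normrN !pN !pE na => h1 /(_ erefl) h2.
have cs : c * s = a * (c * `|k|) by rewrite mulrCA /a divfK ?gt_eqF.
by rewrite ler_norml -(ler_pM2l a0) -[X in _ && X](ler_pM2l a0); lra.
Qed.

Lemma approx_slope_close p q (e1 e2 r1 r2 : R) z : 0 < r1 -> 0 < r2 ->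
  approx_slope J f p e1 r1 z -> approx_slope J f q e2 r2 z ->
  forall h, `|p h - q h| <= (e1 + e2) * `|h|.
Proof.
move=> r10 r20 H1 H2; pose s := Num.min r1 r2 / 2.
have m0 : 0 < Num.min r1 r2 by rewrite lt_min r10.
have s0 : 0 < s by rewrite divr_gt0.
have slt : s < Num.min r1 r2 by rewrite /s; lra.
apply: (linear_le_of_sphere s0) => k ks.
have := H1 k; have := H2 k; move: slt; rewrite lt_min -ks => /andP[-> ->].
move=> /(_ isT) + /(_ isT); rewrite !ler_norml => /andP[] + + /andP[].
rewrite mulrDl; lra.
Qed.

(** The error of the increment depends continuously on the base point, so a strict violation at [z]
    would persist at points of [S] near [z]. This carries slopes from a set to its closure. *)
Lemma increment_closure (S : set V) (z v : V) (c b : R) :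
  closure S z -> {for z, continuous f} -> {for z + v, continuous f} ->
  (\forall s \near z, S s -> `|f (s + v) - f s - c| <= b) ->
  `|f (z + v) - f z - c| <= b.
Proof.
move=> Sz fz fzv H; rewrite leNgt; apply/negP => ltb.
have cv : (fun s => `|f (s + v) - f s - c|) @ z --> `|f (z + v) - f z - c|.
  apply: cvg_norm; apply: cvgB; last exact: cvg_cst.
  apply: cvgB; last exact: fz.
  apply: (@continuous_comp _ _ _ (fun s => s + v) f); last exact: fzv.
  by apply: cvgD; [exact: cvg_id|exact: cvg_cst].
have H2 : \forall s \near z, b < `|f (s + v) - f s - c|.
  exact: (cvgr_gt _ cv).
have [s [Ss [/(_ Ss)]]] := Sz _ (filterI H H2).
by move=> /le_lt_trans h /h; rewrite ltxx.
Qed.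

End Slopes.

(** Cut the interval from [0] to [t] into equal steps shorter than [tau] and add up the
    increments. *)
Lemma increment_le (R : realType) (phi : R -> R) (c t tau : R) :
  0 < t -> 0 < tau ->
  (forall s s', 0 <= s -> s < s' -> s' <= t -> s' - s < tau ->
     phi s' - phi s <= c * (s' - s)) ->
  phi t - phi 0 <= c * t.
Proof.
move=> t0 tau0 H.
have [N Nlt] : exists N : nat, t / tau < N.+1%:R.
  exists (Num.truncn (t / tau)).
  by have := @truncnS_gt R (t / tau).
have N0 : 0 < N.+1%:R :> R by [].
pose d := t / N.+1%:R.
have d0 : 0 < d by rewrite divr_gt0.
have dtau : d < tau by rewrite /d ltr_pdivrMr// mulrC -ltr_pdivrMr.
have dN : N.+1%:R * d = t by rewrite /d mulrC divfK ?gt_eqF.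
suff K k : (k <= N.+1)%N -> phi (k%:R * d) - phi 0 <= c * (k%:R * d).
  by have := K _ (leqnn N.+1); rewrite dN.
elim: k => [_|k IH kN]; first by rewrite mul0r subrr mulr0.
have := IH (ltnW kN).
have e1 : k.+1%:R * d = k%:R * d + d by rewrite -natr1 mulrDl mul1r.
have := H (k%:R * d) (k.+1%:R * d).
have -> : 0 <= k%:R * d by rewrite mulr_ge0// ltW.
have -> : k.+1%:R * d <= t by rewrite -dN ler_wpM2r ?ler_nat// ltW.
rewrite e1 ltrDl d0 (addrC _ d) addrK dtau => /(_ isT isT isT isT).
rewrite mulrDr; lra.
Qed.

(** The bound [M] expresses the continuity of the differential, and the slopes at every [e] express
    that the remainder is negligible. *)
Lemma differentiable_slopeP (R : realType) (V : normedModType R)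
    (f : V -> R) x :
  differentiable f x <->
  exists2 p : {linear V -> R}, exists M, forall h, `|p h| <= M * `|h| &
    forall e, 0 < e -> exists2 r, 0 < r & approx_slope id f p e r x.
Proof.
split=> [dfx|[p [M pM] fp]].
  have [pc pf] := (diff_locallyP x f).1 dfx.
  exists ('d f x).
    have /linear_boundedP[M [_ HM]] :=
      (linear_bounded_continuous ('d f x)).2 pc.
    by exists (M + 1) => h; apply: HM; lra.
  move=> e e0.
  move/eqaddoP: pf => /(_ e e0) /nbhs_normP[r /= r0 H].
  exists r => // h hr.
  have := H h; rewrite /= sub0r normrN => /(_ hr).
  by rewrite !fctE /= opprD addrA (addrC h).
have pc : continuous p.
  apply/linear_bounded_continuous/linear_boundedP.
  exists M; split; first exact: num_real.
  by move=> y My z; rewrite (le_trans (pM z))// ler_wpM2r// ltW.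
have pf : f \o shift x = cst (f x) + p +o_ 0 id.
  apply/eqaddoP => e e0; have [r r0 H] := fp e e0.
  apply/nbhs_normP; exists r => // h /=; rewrite sub0r normrN => hr.
  by have := H h hr; rewrite !fctE /= opprD addrA (addrC h).
have dp := diff_unique pc pf.
by apply/diff_locallyP; rewrite dp.
Qed.

(** * Sets of points with a slope up to a fixed radius, and the Lipschitz case *)

Section SlopeSets.
Context (R : realType) (E V : normedModType R) (J : {linear E -> V}).
Context (J_isometry : forall h, `|J h| = `|h|).
Context (G : set V) (f : V -> R).
Implicit Types (p q : {linear E -> R}) (x z : V).

(** The single integer [m] controls the radius of validity, the distance to the complement of [G]
    and the norm of the slope, so that countably many sets suffice. *)
Definition slope_set (m : nat) (e : R) : set V :=
  [set z | ball z m.+1%:R^-1 `<=` G /\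
    exists2 p : {linear E -> R}, forall h, `|p h| <= m.+1%:R * `|h| &
      approx_slope J f p e m.+1%:R^-1 z].

(** The error may grow with the displacement of the base point: in the telescoping, this
    displacement is at most a multiple of the norm of the whole increment. *)
Definition stable_slope (p : E -> R) (x : V) : Prop :=
  forall e, 0 < e -> exists2 d, 0 < d & forall z h, `|z - x| < d -> `|h| < d ->
    `|f (z + J h) - f z - p h| <= e * (`|h| + `|z - x|).

Lemma ball_add z h (r : R) : `|h| < r -> ball z r (z + J h).
Proof.
by move=> hr; rewrite -ball_normE /= opprD addrA subrr sub0r normrN J_isometry.
Qed.

Lemma slope_set_intro p x (M : R) : open G -> G x ->
  (forall h, `|p h| <= M * `|h|) ->
  (forall e, 0 < e -> exists2 r, 0 < r & approx_slope J f p e r x) ->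
  forall e, 0 < e -> exists m, [/\ ball x m.+1%:R^-1 `<=` G,
    forall h, `|p h| <= m.+1%:R * `|h| & approx_slope J f p e m.+1%:R^-1 x].
Proof.
move=> oG Gx pM px e e0; have [r r0 xr] := px e e0.
have /nbhs_ballP[r' /= r'0 r'G] : nbhs x G by exact: open_nbhs_nbhs.
pose K := Num.max (Num.max r^-1 r'^-1) M.
have := @truncnS_gt R K; set m := Num.truncn K.
rewrite !gt_max => /andP[/andP[m1 m2] m3]; exists m; split.
- by apply: subset_trans r'G; apply: le_ball; rewrite invf_ple ?posrE// ltW.
- by move=> h; rewrite (le_trans (pM h))// ler_wpM2r// ltW.
- move=> h hm; apply: xr; rewrite (lt_le_trans hm)// invf_ple ?posrE//.
  exact: ltW.
Qed.

Lemma exists_invn_lt (e : R) : 0 < e -> exists j : nat, j.+1%:R^-1 < e.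
Proof.
move=> e0; exists (Num.truncn e^-1).
by rewrite invf_plt ?posrE//; exact: truncnS_gt.
Qed.

Lemma lipschitz_stable_slope (L M : R) p x : 0 <= L ->
  (forall y z, G y -> G z -> `|f y - f z| <= L * `|y - z|) ->
  open G -> G x -> (forall h, `|p h| <= M * `|h|) ->
  (forall e, 0 < e -> exists2 r, 0 < r & approx_slope J f p e r x) ->
  (forall m j, slope_set m j.+1%:R^-1 x ->
     ~ porous_at (slope_set m j.+1%:R^-1) x) ->
  stable_slope p x.
Proof.
move=> L0 fL oG Gx pM px nporous e e0.
have [j je] := exists_invn_lt (e := e / 8) ltac:(lra).
have := nporous ^~ j.
have : 0 < j.+1%:R^-1 :> R by [].
have : j.+1%:R^-1 <= 1 :> R by rewrite invf_le1// ler1n.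
move: je; set eta := _^-1 => etae eta1 eta0 {}nporous.
have [m [xG pm xm]] := slope_set_intro oG Gx pM px eta0.
have xS : slope_set m eta x by split=> //; exists p.
have {nporous} := nporous m xS.
have rho0 : 0 < m.+1%:R^-1 :> R by [].
move: xG xm xS rho0; set S := slope_set m eta; rewrite /S /slope_set.
set rho : R := m.+1%:R^-1; rewrite -/S => xG xm xS rho0 nporous.
(* With this [c], moving both ends of an increment from [z] to a point within [c * |z - x|] costs at
   most [2 * L * c * |z - x| <= eta * |z - x|]. *)
pose c := eta / (2 * L + 1).
have L1 : 0 < 2 * L + 1 by lra.
have c0 : 0 < c by rewrite divr_gt0.
have ceta : 2 * L * c + c = eta by rewrite /c; field; rewrite gt_eqF.
have c1 : c <= 1 by nra.
(* This is the failure of porosity at [x] for the constant [c]. *)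
have [d0 d00 near_S] : exists2 d0, 0 < d0 & forall t, ball x d0 t -> t != x ->
    exists2 a, S a & `|t - a| < c * `|t - x|.
  apply: contrapT => H; apply: nporous; exists c => // d d_gt0.
  apply: contrapT => H2; apply: H; exists d => // t xt tx.
  apply: contrapT => H3; apply: H2; exists t; split=> //.
  rewrite -subset0 => a [/= ta Sa]; apply: H3; exists a => //.
  by move: ta; rewrite -ball_normE.
pose s := rho / 2.
(* Since [|a - x| <= 2 * d1] below, increments over the sphere of radius [s] taken at [a] and at [x]
   differ by at most [4 * L * d1 <= eta * s]. *)
pose d1 := eta * s / (4 * L + 1).
have L4 : 0 < 4 * L + 1 by lra.
have s0 : 0 < s by rewrite /s; lra.
have d10 : 0 < d1 by rewrite divr_gt0// mulr_gt0.
have Ld1 : 4 * L * d1 + d1 = eta * s by rewrite /d1; field; rewrite gt_eqF.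
exists (Num.min (Num.min d0 d1) (rho / 4)).
  by rewrite !lt_min d00 d10; lra.
move=> z h; rewrite !lt_min => /andP[/andP[zd0 zd1] zrho].
move=> /andP[/andP[hd0 hd1] hrho].
have [->|zx] := eqVneq z x.
  rewrite subrr normr0 addr0 (le_trans (xm h _))//; first by rewrite -/rho; lra.
  by rewrite ler_wpM2r//; lra.
have [|a Sa aclose] := near_S z _ zx.
  by rewrite -ball_normE /= distrC.
have azx : `|a - x| <= 2 * `|z - x|.
  have := ler_distD z a x; rewrite (distrC a z); have := normr_ge0 (z - x); nra.
have [aG [p' p'm am]] := Sa.
(* One [eta] comes from the slope at [a], one from the slope at [x], one from the Lipschitz
   comparison of the two increments. *)
have pp' : forall k, `|p' k - p k| <= (3 * eta) * `|k|.
  apply: (linear_le_of_sphere s0) => k ks.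
  have := am k; have := xm k; rewrite ks -/rho.
  have srho : s < rho by rewrite /s; lra.
  move=> /(_ srho) + /(_ srho); rewrite !ler_norml => /andP[h1 h2] /andP[h3 h4].
  have := fL (a + J k) (x + J k) (aG _ (ball_add _ _)) (xG _ (ball_add _ _)).
  rewrite ks => /(_ srho srho).
  rewrite opprD addrACA subrr addr0 ler_norml => /andP[h5 h6].
  have := fL a x (aG _ (ballxx _ _)) Gx => /(_ rho0).
  rewrite ler_norml => /andP[h7 h8].
  have : L * `|a - x| <= L * (2 * d1) by rewrite ler_wpM2l//; lra.
  nra.
(* The total error is [eta * |h|] at [a], [3 * eta * |h|] from replacing [p'] by [p], and
   [eta * |z - x|] from moving [a] to [z]. *)
have := am h; rewrite -/rho; have hr : `|h| < rho by lra.
move=> /(_ hr); rewrite ler_norml => /andP[h1 h2].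
have := pp' h; rewrite ler_norml => /andP[h3 h4].
have Gz : G z by apply: xG; rewrite -ball_normE /= distrC -/rho; lra.
have Gzh : G (z + J h).
  apply: xG; rewrite -ball_normE /= opprD addrA -/rho.
  by rewrite (le_lt_trans (ler_normB _ _))// J_isometry distrC; lra.
have := fL (z + J h) (a + J h) Gzh (aG _ (ball_add _ hr)).
rewrite opprD addrACA subrr addr0 ler_norml => /andP[h5 h6].
have := fL z a Gz (aG _ (ballxx _ _)) => /(_ rho0).
rewrite ler_norml => /andP[h7 h8].
have h9 : L * `|z - a| <= L * (c * `|z - x|) by rewrite ler_wpM2l// ltW.
have h10 := normr_ge0 h; have h11 := normr_ge0 (z - x).
have h12 : 2 * (L * (c * `|z - x|)) <= eta * `|z - x|.
  by rewrite -ceta; nra.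
have h13 : eta * (`|h| + `|z - x|) * 8 <= e * (`|h| + `|z - x|).
  rewrite mulrAC ler_wpM2r ?addr_ge0//; lra.
have h14 : 0 <= eta * `|z - x| by rewrite mulr_ge0// ltW.
have h15 : 0 <= eta * `|h| by rewrite mulr_ge0// ltW.
by rewrite ler_norml; apply/andP; split; lra.
Qed.

End SlopeSets.

(** * Asplund spaces and the continuous case *)

(** By the Baire theorem, the complements of the closures of countably many nowhere dense sets have
    a common point. *)
Lemma asplund_differentiable_point (R : realType)
    (E : completeNormedModType R) (g : E -> R) :
  asplund E -> continuous g -> convex_function setT g ->
  exists u, differentiable g u.
Proof.
move=> aE gc gcvx; have [F Fnd Fg] := aE g gc gcvx.
have Fdense k : open (~` closure (F k)) /\ dense (~` closure (F k)).
  split; first by rewrite openC; exact: closed_closure.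
  move=> O [x Ox] oO; apply: contrapT => H.
  suff : (closure (F k))^° x by rewrite Fnd.
  have : nbhs x O by exact: open_nbhs_nbhs.
  by apply: filterS => y Oy; apply: contrapT => Fy; apply: H; exists y.
have [u [_ Fu]] := Baire Fdense (ex_intro _ (0 : E) I) openT.
exists u; apply: contrapT => nd.
have : (\bigcup_k F k) u by rewrite -Fg.
by move=> [k _ Fku]; apply: (Fu k I); exact: subset_closure.
Qed.

Lemma sublinear_convex (R : realType) (E : normedModType R) (g : E -> R) :
  (forall u v, g (u + v) <= g u + g v) ->
  (forall a u, 0 <= a -> g (a *: u) <= a * g u) ->
  convex_function setT g.
Proof.
move=> gD gZ t x y _ _; rewrite (le_trans (gD _ _))//.
by rewrite lerD// gZ// subr_ge0.
Qed.

Lemma lipschitz_continuous (R : realType) (E : normedModType R) (g : E -> R)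
    (K : R) : (forall u v, g u - g v <= K * `|u - v|) -> continuous g.
Proof.
move=> gK u; apply/cvgrPdist_lt => e e0.
have K0 : 0 < `|K| + 1 by rewrite ltr_wpDl.
near=> v.
have : `|u - v| < e / (`|K| + 1).
  by near: v; apply: cvgr_dist_lt => //; rewrite divr_gt0.
rewrite ltr_pdivlMr// => h1.
have h2 := gK u v; have := gK v u; rewrite (distrC v) => h3.
have h4 := ler_norm K; have h5 := normr_ge0 (u - v).
have : `|u - v| * K <= `|u - v| * `|K| by rewrite ler_wpM2l.
rewrite ltr_norml; lra.
Unshelve. all: by end_near. Qed.

(* g u is the supremum of the difference quotients of f in the direction J u
   inside the ball; as segments can be subdivided, only arbitrarily short
   increments matter, and this makes g sublinear. Near a point u where g is
   Frechet differentiable, an increment nearly realizing g u still does so for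
   nearby base points, by continuity of f. *)
Lemma uniform_upper_slope (R : realType) (V : normedModType R)
    (E : completeNormedModType R) (J : {linear E -> V}) (f : V -> R)
    (x : V) (r K e : R) :
  (forall h, `|J h| = `|h|) -> asplund E -> 0 < r -> 0 < e ->
  (forall z, ball x r z -> {for z, continuous f}) ->
  (forall z h, ball x r z -> ball x r (z + J h) ->
     `|f (z + J h) - f z| <= K * `|h|) ->
  exists q : {linear E -> R}, exists w kappa s,
    [/\ 0 < kappa, ball w kappa `<=` ball x r, 0 < s < r &
        forall z k, ball w kappa z -> `|k| = s ->
          f (z + J k) - f z <= q k + 2 * e * `|k|].
Proof.
move=> Jn aE r0 e0 fc fK.
pose Q u := [set y | exists z t, [/\ ball x r z, ball x r (z + J (t *: u)),
   0 < t & y = (f (z + J (t *: u)) - f z) / t]].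
pose g u := sup (Q u).
have Bball z h : `|z - x| + `|h| < r -> ball x r (z + J h).
  move=> H; rewrite -ball_normE /= distrC addrAC.
  by rewrite (le_lt_trans (ler_normD _ _))// Jn.
have ballN z : ball x r z = (`|z - x| < r) :> Prop.
  by rewrite -ball_normE /= distrC.
(* Together with the bound [QK], this makes [sup (Q u)] a true supremum rather than a default
   value. *)
have Q0 u : Q u !=set0.
  pose t := r / (2 * (`|u| + 1)).
  have u1 : 0 < 2 * (`|u| + 1) by rewrite mulr_gt0// ltr_wpDl.
  have t0 : 0 < t by rewrite divr_gt0.
  have tu : t * (2 * (`|u| + 1)) = r by rewrite /t divfK ?gt_eqF.
  exists ((f (x + J (t *: u)) - f x) / t), x, t; split=> //.
    exact: ballxx.
  apply: Bball; rewrite subrr normr0 add0r normrZ gtr0_norm//.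
  have := normr_ge0 u; nra.
have QK u y : Q u y -> y <= K * `|u|.
  move=> [z [t [zB ztB t0 ->]]]; rewrite ler_pdivrMr//.
  rewrite (le_trans (ler_norm _))// (le_trans (fK _ _ zB ztB))//.
  by rewrite normrZ gtr0_norm// mulrA mulrAC.
have g_ub u z t : ball x r z -> ball x r (z + J (t *: u)) -> 0 < t ->
    f (z + J (t *: u)) - f z <= t * g u.
  move=> zB ztB t0; rewrite mulrC -ler_pdivrMr//.
  apply: ub_le_sup; last by exists z, t.
  by exists (K * `|u|) => y; exact: QK.
have g_le u c : (forall z t, ball x r z -> ball x r (z + J (t *: u)) ->
    0 < t -> f (z + J (t *: u)) - f z <= t * c) -> g u <= c.
  move=> H; apply: ge_sup => // _ [z [t [zB ztB t0 ->]]].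
  by rewrite ler_pdivrMr// mulrC; exact: H.
(* A segment with ends in the closed ball of radius [rho] stays in it by convexity, so
   [increment_le] reduces the bound to short increments there. The gap [r - rho] leaves room for
   points off the segment. *)
have g_le_loc u c : (forall rho, rho < r -> exists2 tau, 0 < tau &
    forall z t, `|z - x| <= rho -> `|z + J (t *: u) - x| <= rho ->
    0 < t -> t < tau -> f (z + J (t *: u)) - f z <= t * c) -> g u <= c.
  move=> H; apply: g_le => z t zB ztB t0.
  pose rho := Num.max `|z - x| `|z + J (t *: u) - x|.
  have rhor : rho < r by move: zB ztB; rewrite !ballN gt_max => -> ->.
  have [tau tau0 {}H] := H rho rhor.
  have seg s : 0 <= s -> s <= t -> `|z + J (s *: u) - x| <= rho.
    move=> s0 st.
    have -> : z + J (s *: u) - x =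
        (1 - s / t) *: (z - x) + (s / t) *: (z + J (t *: u) - x).
      rewrite (addrAC z (J (s *: u))) (addrAC z (J (t *: u))).
      rewrite (scalerDr (s / t)) addrA -scalerDl subrK scale1r.
      by rewrite -linearZ /= scalerA divfK ?gt_eqF.
    have st1 : s / t <= 1 by rewrite ler_pdivrMr// mul1r.
    have st0 : 0 <= s / t by rewrite divr_ge0// ltW.
    have st2 : 0 <= 1 - s / t by rewrite subr_ge0.
    rewrite (le_trans (ler_normD _ _))// (normrZ (1 - s / t)).
    rewrite (normrZ (s / t)) (ger0_norm st0) (ger0_norm st2).
    have h1 : `|z - x| <= rho by rewrite le_max lexx.
    have h2 : `|z + J (t *: u) - x| <= rho by rewrite le_max lexx orbT.
    nra.
  have := @increment_le R (fun s => f (z + J (s *: u))) c t tau t0 tau0.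
  rewrite scale0r linear0 addr0 (mulrC t); apply.
  move=> s s' s0 ss' s't st.
  have := H (z + J (s *: u)) (s' - s).
  have -> : z + J (s *: u) + J ((s' - s) *: u) = z + J (s' *: u).
    by rewrite -addrA -linearD /= -scalerDl (addrC s) subrK.
  rewrite (mulrC c).
  apply => //; rewrite ?subr_gt0// seg//.
  - by rewrite (le_trans _ s't)// ltW.
  - by rewrite (le_trans s0)// ltW.
(* Move by [t *: u] and then by [t *: v]; for small [t] the intermediate point remains in the ball
   of radius [r]. *)
have gD u v : g (u + v) <= g u + g v.
  apply: g_le_loc => rho rhor.
  have u1 : 0 < `|u| + 1 by rewrite ltr_wpDl.
  exists ((r - rho) / (`|u| + 1)); first by rewrite divr_gt0// subr_gt0.
  move=> z t zrho ztrho t0; rewrite ltr_pdivlMr// => tr.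
  have zuB : ball x r (z + J (t *: u)).
    apply: Bball; rewrite normrZ gtr0_norm//; nra.
  have zB : ball x r z by rewrite ballN; lra.
  have := g_ub u z t zB zuB t0.
  have := g_ub v (z + J (t *: u)) t zuB.
  rewrite -addrA -linearD /= -scalerDr ballN => /(_ _ t0).
  have -> : `|z + J (t *: (u + v)) - x| < r by lra.
  move=> /(_ isT); rewrite mulrDr; lra.
have gub u : g u <= K * `|u| by apply: ge_sup => // y; exact: QK.
have g0 : g 0 = 0.
  apply/eqP; rewrite eq_le; apply/andP; split.
    by have := gub 0; rewrite normr0 mulr0.
  have := g_ub 0 x 1; rewrite scaler0 linear0 addr0 subrr mul1r.
  by apply => //; exact: ballxx.
have gZ a u : 0 <= a -> g (a *: u) <= a * g u.
  rewrite [0 <= a]le_eqVlt => /predU1P[<-|a0].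
    by rewrite scale0r g0 mul0r.
  apply: g_le => z t zB; rewrite scalerA => ztB t0; rewrite mulrA.
  by apply: g_ub => //; rewrite mulr_gt0.
have gc : continuous g.
  apply: (@lipschitz_continuous _ _ _ K) => u v.
  have := gD (u - v) v; rewrite subrK; have := gub (u - v); lra.
have [u gu_diff] := asplund_differentiable_point aE gc (sublinear_convex gD gZ).
have [q _ gq] := (differentiable_slopeP g u).1 gu_diff.
have [d' d'0 gd'] := gq e e0.
pose d := d' / 2.
have d0 : 0 < d by rewrite /d; lra.
have dd' : d < d' by rewrite /d; lra.
(* Otherwise [g_le_loc] would give the smaller bound [g u - e * d]. The nearly maximal increments
   can thus be arbitrarily short with [rho] fixed. *)
have [rho rhor near_sup] : exists2 rho, rho < r & forall tau, 0 < tau ->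
    exists z t, [/\ `|z - x| <= rho, `|z + J (t *: u) - x| <= rho,
      0 < t < tau & t * (g u - e * d) < f (z + J (t *: u)) - f z].
  apply: contrapT => H.
  suff : g u <= g u - e * d by have := mulr_gt0 e0 d0; lra.
  apply: g_le_loc => rho rhor; apply: contrapT => H2; apply: H.
  exists rho => // tau tau0; apply: contrapT => H3; apply: H2.
  exists tau => // z t zr ztr t0 tt.
  rewrite leNgt; apply/negP => H4; apply: H3; exists z, t; split=> //.
  by rewrite t0.
have ud0 : 0 < 2 * (`|u| + d + 1) by have := normr_ge0 u; lra.
have [|z [t [zrho ztrho /andP[t0]]]] :=
    near_sup ((r - rho) / (2 * (`|u| + d + 1))).
  by rewrite divr_gt0// subr_gt0.
rewrite ltr_pdivlMr// => tr big.
pose w0 := z + J (t *: u).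
have rho0 : 0 <= rho by exact: le_trans zrho.
have big_near : \forall w \near w0,
    t * (g u - e * d) < f w - f (w - J (t *: u)).
  have cv : (fun w => f w - f (w - J (t *: u))) @ w0 --> f w0 - f z.
    apply: cvgB; first by apply: fc; rewrite ballN; lra.
    rewrite -[z](addrK (J (t *: u))) -/w0.
    apply: (@continuous_comp _ _ _ (fun w => w - J (t *: u)) f).
      by apply: cvgB; [exact: cvg_id|exact: cvg_cst].
    by apply: fc; rewrite /w0 addrK ballN; lra.
  exact: (cvgr_gt _ cv).
have /nbhs_ballP[k1 /= k10 k1w] := big_near.
have s0 : 0 < t * d by rewrite mulr_gt0.
(* The radius [t * d] of the sphere is chosen so that [t^-1 *: k] has norm [d], where the derivative
   of [g] at [u] is accurate up to [e * d]. *)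
exists q, w0, (Num.min k1 ((r - rho) / 2)), (t * d).
have kball y : ball w0 (Num.min k1 ((r - rho) / 2)) y ->
    ball w0 k1 y /\ `|y - w0| < (r - rho) / 2.
  by rewrite -ball_normE /= lt_min (distrC w0) => /andP[].
split=> //.
- by rewrite lt_min k10 /=; lra.
- move=> y /kball[_ yw]; rewrite ballN.
  by have := ler_distD w0 y x; rewrite -/w0 in ztrho *; lra.
- by rewrite s0; have := normr_ge0 u; nra.
move=> y k /kball[/k1w /= ybig yw] ks.
pose y' := y - J (t *: u).
have y'z : `|y' - z| < (r - rho) / 2.
  by rewrite /y' -addrA -opprD (addrC _ z).
have y'x : `|y' - x| < (r + rho) / 2 by have := ler_distD z y' x; lra.
have hd : `|t^-1 *: k| = d.
  by rewrite normrZ normfV gtr0_norm// ks mulKf ?gt_eqF.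
have ytk : y' + J (t *: (u + t^-1 *: k)) = y + J k.
  by rewrite scalerDr scalerA divff ?gt_eqF// scale1r linearD /= addrA subrK.
have y'B : ball x r y' by rewrite ballN; lra.
have y'kB : ball x r (y' + J (t *: (u + t^-1 *: k))).
  apply: Bball; rewrite normrZ gtr0_norm//.
  have := ler_normD u (t^-1 *: k); rewrite hd; nra.
(* The increment from [y'] to [y + J k] is at most [t * g u + q k + e * t * d], while the one from
   [y'] to [y] exceeds [t * g u - e * t * d]. Their difference is at most [q k + 2 * e * |k|]. *)
have := g_ub (u + t^-1 *: k) y' t y'B y'kB t0; rewrite ytk => up.
have := gd' (t^-1 *: k); rewrite hd => /(_ dd') /=.
rewrite ler_norml => /andP[_].
have -> : q (t^-1 *: k) = t^-1 * q k by rewrite linearZ.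
move=> gu.
have tq : t * (t^-1 * q k) = q k by rewrite mulrA divff ?gt_eqF// mul1r.
have : t * g (u + t^-1 *: k) <= t * (g u + t^-1 * q k + e * d).
  by apply: ler_wpM2l; [exact: ltW|lra].
rewrite !mulrDr tq ks; move: ybig; rewrite -/y'; lra.
Qed.

Definition uniform_slope (R : realType) (E V : normedModType R) (J : E -> V)
    (f : V -> R) (e : R) : set V :=
  [set x | exists q : {linear E -> R},
    exists2 r, 0 < r & forall z, ball x r z -> approx_slope J f q e r z].

Lemma unstable_nowhere_dense (R : realType) (V : normedModType R)
    (E : completeNormedModType R) (J : {linear E -> V}) (G : set V)
    (f : V -> R) (m : nat) (e : R) :
  (forall h, `|J h| = `|h|) -> asplund E ->
  (forall z, G z -> {for z, continuous f}) -> 0 < e ->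
  nowhere_dense (slope_set J G f m e `\` uniform_slope J f (4 * e)).
Proof.
move=> Jn aE fc e0; rewrite /nowhere_dense -subset0 => x /= xint.
set S := slope_set J G f m e; set B := S `\` _ in xint.
have /nbhs_ballP[r1 /= r10 r1B] : nbhs x (closure B) by exact: xint.
have rho0 : 0 < m.+1%:R^-1 :> R by [].
move: rho0; set rho : R := m.+1%:R^-1 => rho0.
(* Two points of the ball of radius [r] are then less than [rho] apart, within reach of the slopes
   of [S]. *)
pose r := Num.min r1 (rho / 2).
have r0 : 0 < r by rewrite lt_min r10; lra.
have rrho : r <= rho / 2 by rewrite ge_min lexx orbT.
have BS : closure B `<=` closure S by apply: closure_subset => y [].
have rB z : ball x r z -> closure B z.
  by move=> xz; apply: r1B; apply: le_ball xz; rewrite ge_min lexx.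
have SG z : closure S z -> ball z rho `<=` G.
  move=> Sz y; rewrite -ball_normE /= => zy.
  have t0 : 0 < rho - `|z - y| by rewrite subr_gt0.
  have [s [[sG _]]] := Sz _ (nbhsx_ballx z _ t0).
  rewrite -ball_normE /= => zs; apply: sG; rewrite -ball_normE /= -/rho.
  by have := ler_distD z s y; rewrite (distrC s z); lra.
have fcS z h : closure S z -> `|h| < rho -> {for z + J h, continuous f}.
  by move=> Sz hr; apply: fc; apply: (SG z Sz); exact: ball_add.
have fcS0 z : closure S z -> {for z, continuous f}.
  by move=> Sz; apply: fc; apply: (SG z Sz); exact: ballxx.
have fK z h : ball x r z -> ball x r (z + J h) ->
    `|f (z + J h) - f z| <= (m.+1%:R + e) * `|h|.
  move=> xz xzh; have Sz := BS _ (rB _ xz).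
  have hrho : `|h| < rho.
    move: xz xzh; rewrite -!ball_normE /= => xz xzh.
    rewrite -Jn (_ : J h = (x - z) - (x - (z + J h))).
      by rewrite (le_lt_trans (ler_normB _ _))//; lra.
    by rewrite opprB addrC addrA subrK addrAC subrr add0r.
  rewrite -[X in `|X|]subr0; apply: (increment_closure Sz) => //.
  - exact: fcS0.
  - exact: fcS.
  - near=> s => -[_ [p pm sp]]; have := sp h hrho; have := pm h.
    rewrite subr0 !ler_norml => /andP[h1 h2] /andP[h3 h4].
    by rewrite mulrDl; lra.
have [z xz|q [w [kappa [s [kappa0 wB /andP[s0 sr] up]]]]] :=
  uniform_upper_slope Jn aE r0 e0 _ fK.
- exact/fcS0/BS/rB.
have slopeS y : S y -> ball w kappa y -> approx_slope J f q (4 * e) rho y.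
  move=> [yG [p pm yp]] wy k kr.
  (* The upper slope contributes [2 * e] and the slope at [y] contributes [e]; one more [e] from [y]
     gives the final [4 * e]. *)
  have pq : forall h, `|p h - q h| <= (3 * e) * `|h|.
    apply: (linear_le_of_sphere s0) => h hs.
    have srho : s < rho by lra.
    have := up y h wy hs; have := yp h; rewrite hs => /(_ srho).
    by rewrite ler_norml; lra.
  have := yp k kr; have := pq k; rewrite !ler_norml; lra.
have wcl : closure B w by exact/rB/wB/ballxx.
(* Points of [S] are dense near [v], so [q] is a slope at every point near [v], against the choice
   of [v] outside [uniform_slope]. *)
have [v [[Sv nv] wv]] := wcl _ (nbhsx_ballx w kappa kappa0).
apply: nv; exists q.
pose t := Num.min (kappa - `|w - v|) rho.
have wv' : `|w - v| < kappa by move: wv; rewrite -ball_normE.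
exists t; first by rewrite lt_min rho0 subr_gt0 wv'.
move=> z; rewrite -ball_normE /= lt_min => /andP[vz _] k.
rewrite lt_min => /andP[_ krho].
have wz : ball w kappa z.
  by rewrite -ball_normE /=; have := ler_distD v w z; lra.
have Sz := BS _ (rB _ (wB _ wz)).
apply: (increment_closure Sz).
- exact: fcS0.
- exact: fcS.
- have : nbhs z (ball w kappa).
    by apply: open_nbhs_nbhs; split=> //; exact: ball_open.
  by apply: filterS => y wy Sy; exact: slopeS.
Unshelve. all: by end_near. Qed.

Lemma continuous_stable_slope (R : realType) (E V : normedModType R)
    (J : {linear E -> V}) (G : set V) (f : V -> R) (p : {linear E -> R})
    (M : R) (x : V) :
  open G -> G x -> (forall h, `|p h| <= M * `|h|) ->
  (forall e, 0 < e -> exists2 r, 0 < r & approx_slope J f p e r x) ->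
  (forall m j, slope_set J G f m j.+1%:R^-1 x ->
     uniform_slope J f (4 * j.+1%:R^-1) x) ->
  stable_slope J f p x.
Proof.
move=> oG Gx pM px stab e e0.
(* The functional [q] is a [4 * eta] slope near [x], and [p] is within [eta + 4 * eta] of it:
   [9 * eta] in all. *)
have [j je] := exists_invn_lt (e := e / 9) ltac:(lra).
have := stab ^~ j; have : 0 < j.+1%:R^-1 :> R by [].
move: je; set eta := _^-1 => etae eta0 {}stab.
have [m [xG pm xm]] := slope_set_intro oG Gx pM px eta0.
have [|q [r r0 rq]] := stab m; first by split=> //; exists p.
have m0 : 0 < m.+1%:R^-1 :> R by [].
have pq := approx_slope_close m0 r0 xm (rq x (ballxx _ r0)).
exists r => // z h zr hr.
have := rq z _ h hr; rewrite -ball_normE /= distrC => /(_ zr).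
have := pq h; rewrite !ler_norml => /andP[h1 h2] /andP[h3 h4].
have h5 := normr_ge0 h; have h6 := normr_ge0 (z - x).
have : eta * `|h| <= e / 9 * `|h| by rewrite ler_wpM2r// ltW.
have : 0 <= e * `|z - x| by rewrite mulr_ge0// ltW.
by rewrite mulrDr; lra.
Qed.

(** * Coordinate injections and telescoping along the coordinates *)

Section Coordinates.
Context (R : realType) (n : nat) (X : 'I_n -> normedModType R).
Implicit Types x h : maxprod X.

Definition coord_inj (i : 'I_n) (t : X i) : maxprod X :=
  eqtype.dfwith (0 : maxprod X) t.

Lemma coord_inj_in i (t : X i) : coord_inj t i = t.
Proof. exact: eqtype.dfwith_in. Qed.

Lemma coord_inj_out i (t : X i) j : i != j -> coord_inj t j = 0.
Proof. exact: eqtype.dfwith_out. Qed.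

Lemma coord_inj_is_linear i : linear (@coord_inj i).
Proof.
move=> a u v; apply: functional_extensionality_dep => j.
rewrite [RHS]/(a *: coord_inj u j + coord_inj v j).
have [<-|ij] := eqVneq i j; first by rewrite !coord_inj_in.
by rewrite !coord_inj_out// scaler0 [RHS]addr0.
Qed.

HB.instance Definition _ i := GRing.isLinear.Build R (X i) (maxprod X) *:%R
  (@coord_inj i) (@coord_inj_is_linear i).

Lemma le_coord_norm h i : `|h i| <= `|h|.
Proof. exact: (le_bigmax _ (fun j => `|h j|)). Qed.

Lemma norm_coord_inj i (t : X i) : `|coord_inj t| = `|t|.
Proof.
apply/eqP; rewrite eq_le; apply/andP; split.
  apply/bigmax_leP; split=> // j _.
  have [<-|ij] := eqVneq i j; first by rewrite coord_inj_in.
  by rewrite coord_inj_out// normr0.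
by rewrite -{1}(coord_inj_in t) le_coord_norm.
Qed.

Lemma dfwith_coord x i (t : X i) :
  eqtype.dfwith x (x i + t) = x + coord_inj t :> maxprod X.
Proof.
apply: functional_extensionality_dep => j.
rewrite [RHS]/(x j + coord_inj t j).
have [<-|ij] := eqVneq i j; first by rewrite eqtype.dfwith_in coord_inj_in.
by rewrite eqtype.dfwith_out// coord_inj_out// [RHS]addr0.
Qed.

Lemma sum_coord_inj h : h = \sum_i coord_inj (h i).
Proof.
apply: functional_extensionality_dep => j.
have -> : (\sum_i coord_inj (h i)) j = \sum_i coord_inj (h i) j.
  by elim/big_rec2 : _ => // i u v _ <-.
rewrite (bigD1 j)//= coord_inj_in big1 ?addr0// => i ij.
by rewrite coord_inj_out.
Qed.

Lemma partial_slope (f : maxprod X -> R) x i : partial_differentiable f x i ->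
  exists2 p : {linear X i -> R}, exists M, forall t, `|p t| <= M * `|t| &
    forall e, 0 < e ->
      exists2 r, 0 < r & approx_slope (@coord_inj i) f p e r x.
Proof.
move=> /differentiable_slopeP[p pM px]; exists p => // e /px[r r0 pr].
exists r => // t /pr; rewrite dfwith_coord.
have -> // : eqtype.dfwith x (x i) = x :> maxprod X.
by rewrite -[x i]addr0 dfwith_coord linear0 addr0.
Qed.

End Coordinates.

(** The increment along [l] starts at [x] itself, so a slope at [x] is enough there; every other
    coordinate is changed from a displaced point, which calls for a stable slope. *)
Lemma stable_partial_differentiable (R : realType) (n : nat)
    (X : 'I_n -> normedModType R) (f : maxprod X -> R) (x : maxprod X)
    (l : 'I_n) (p : forall i, {linear X i -> R}) :
  (forall i, exists M, forall t, `|p i t| <= M * `|t|) ->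
  (forall e, 0 < e ->
    exists2 r, 0 < r & approx_slope (@coord_inj _ _ X l) f (p l) e r x) ->
  (forall i, i != l -> stable_slope (@coord_inj _ _ X i) f (p i) x) ->
  differentiable f x.
Proof.
move=> pM pl ps.
pose P (h : maxprod X) := \sum_i p i (h i).
have P_linear : linear P.
  move=> a u v; rewrite /P scaler_sumr -big_split /=; apply: eq_bigr => i _.
  by rewrite -linearP.
pose PL : {linear maxprod X -> R} :=
  HB.pack P (GRing.isLinear.Build R (maxprod X) R *:%R P P_linear).
apply/differentiable_slopeP; exists PL => [|e e0].
  have [M pMM] := choice pM.
  exists (\sum_i `|M i|) => h; rewrite (le_trans (ler_norm_sum _ _ _))//.
  rewrite mulr_suml; apply: ler_sum => i _; rewrite (le_trans (pMM i _))//.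
  rewrite (@le_trans _ _ (`|M i| * `|h i|))//.
    by rewrite ler_wpM2r// ler_norm.
  by rewrite ler_wpM2l// le_coord_norm.
(* The displacement once coordinate [l] and those listed in [s] have been changed. *)
pose D (s : seq 'I_n) (h : maxprod X) : maxprod X :=
  coord_inj (h l) + \sum_(i <- s) coord_inj (h i).
have D_le s h : `|D s h| <= (size s).+1%:R * `|h|.
  rewrite -natr1 mulrDl mul1r addrC (le_trans (ler_normD _ _))// lerD//.
    by rewrite norm_coord_inj le_coord_norm.
  elim: s => [|i s IH]; first by rewrite big_nil normr0 mul0r.
  rewrite big_cons (le_trans (ler_normD _ _))//= -natr1 mulrDl mul1r addrC.
  rewrite lerD//.
  by rewrite norm_coord_inj le_coord_norm.
have tele s : all (predC1 l) s -> forall e, 0 < e -> exists2 d, 0 < d &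
    forall h, `|h| < d ->
      `|f (x + D s h) - f x - (p l (h l) + \sum_(i <- s) p i (h i))|
        <= e * `|h|.
  elim: s => [_ e' e'0|i s IH /= /andP[il /IH {}IH] e' e'0].
    have [r r0 pr] := pl e' e'0; exists r => // h hr.
    rewrite /D !big_nil !addr0 (le_trans (pr _ _))//.
      by rewrite (le_lt_trans (le_coord_norm h l)).
    by apply: ler_wpM2l; [exact: ltW|exact: le_coord_norm].
  have [d1 d10 H1] := IH (e' / 2) ltac:(lra).
  (* [N * |h|] bounds [|h i| + |D s h|]: one for the new coordinate, one for [l], and [size s] for
     those already changed. *)
  pose N : R := (size s).+2%:R.
  have N0 : 0 < N by [].
  have [d2 d20 H2] := ps i il (e' / 2 / N) ltac:(by rewrite !divr_gt0).
  exists (Num.min d1 (d2 / N)); first by rewrite lt_min d10 divr_gt0.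
  move=> h; rewrite lt_min ltr_pdivlMr// => /andP[hd1 hd2].
  have NE : N * `|h| = (size s).+1%:R * `|h| + `|h|.
    by rewrite /N -natr1 mulrDl mul1r.
  have h0 := normr_ge0 h.
  have hi := le_coord_norm h i.
  have Dh := D_le s h.
  have hN : 0 <= (size s).+1%:R * `|h| by rewrite mulr_ge0.
  have xDs : x + D s h - x = D s h by rewrite addrAC subrr add0r.
  have : `|f (x + D s h + coord_inj (h i)) - f (x + D s h) - p i (h i)| <=
      e' / 2 / N * (`|h i| + `|D s h|).
    by rewrite -{3}xDs; apply: H2; rewrite ?xDs; lra.
  have := H1 h hd1.
  have -> : x + D (i :: s) h = x + D s h + coord_inj (h i).
    by rewrite /D big_cons -addrA; congr (_ + _); rewrite addrA addrAC.
  rewrite big_cons.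
  have : e' / 2 / N * (`|h i| + `|D s h|) <= e' / 2 * `|h|.
    rewrite -mulrA ler_wpM2l//; first lra.
    by rewrite mulrC ler_pdivrMr// mulrC NE; lra.
  rewrite !ler_norml; set T := e' / 2 / N * _; set S := \sum_(j <- s) _.
  by move=> h1 /andP[h2 h3] /andP[h4 h5]; apply/andP; split;
    move: T S h1 h2 h3 h4 h5 => T S; lra.
pose s := [seq i <- index_enum 'I_n | i != l].
have [|d d0 dh] := tele s _ e e0; first exact: filter_all.
exists d => // h hd; have := dh h hd.
have -> : D s h = h by rewrite /D big_filter [RHS]sum_coord_inj [RHS](bigD1 l).
by rewrite /= /P (bigD1 l (F := fun i => p i (h i)))// big_filter.
Qed.

(** * Countable unions of small sets *)

(** Integers that decode to no index contribute the empty set, which is both nowhere dense and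
    porous. *)
Lemma bigcup_unpickle (T : Type) (C : countType) (B : C -> set T) :
  \bigcup_c B c =
  \bigcup_k (if choice.unpickle k is Some c then B c else set0).
Proof.
apply/seteqP; split=> x.
  by move=> [c _ Bx]; exists (choice.pickle c) => //; rewrite choice.pickleK.
by move=> [k _]; case: choice.unpickle => // c Bx; exists c.
Qed.

Lemma nowhere_dense0 (T : topologicalType) : nowhere_dense (set0 : set T).
Proof. by rewrite /nowhere_dense closure0 interior0. Qed.

Lemma first_category_bigcup (T : topologicalType) (C : countType)
    (B : C -> set T) :
  (forall c, nowhere_dense (B c)) -> first_category (\bigcup_c B c).
Proof.
move=> Bnd.
exists (fun k => if choice.unpickle k is Some c then B c else set0); last first.
  exact: bigcup_unpickle.
by move=> k; case: choice.unpickle => [c|]; [exact: Bnd|exact: nowhere_dense0].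
Qed.

Lemma sigma_porous_bigcup (R : realType) (V : normedModType R) (C : countType)
    (B : C -> set V) :
  (forall c, porous (B c)) -> sigma_porous (\bigcup_c B c).
Proof.
move=> Bp.
exists (fun k => if choice.unpickle k is Some c then B c else set0); last first.
  exact: bigcup_unpickle.
by move=> k; case: choice.unpickle => [c|]; [exact: Bp|move=> x].
Qed.

(** A ball that misses [S] misses each of its subsets, so porosity passes to subsets. *)
Lemma porous_at_points (R : realType) (V : normedModType R) (S : set V) :
  porous [set x | S x /\ porous_at S x].
Proof.
move=> x [_ [c c0 H]]; exists c => // d /H[t [xt tx tS]]; exists t; split=> //.
by rewrite -subset0 -tS => y [? []].
Qed.

Lemma slope_set_subset (R : realType) (E V : normedModType R)
    (J : {linear E -> V}) (G : set V) (f : V -> R) (m : nat) (e : R) :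
  slope_set J G f m e `<=` G.
Proof. by move=> x [xG _]; apply: xG; exact: ballxx. Qed.

(** * The exceptional sets, indexed by coordinate, radius and precision *)

Theorem corollary6p8 (R : realType) (n : nat) (n_gt0 : (0 < n)%N)
    (X : 'I_n -> completeNormedModType R)
    (X_nontrivial : forall i, exists v : X i, v != 0)
    (X_asplund : forall i : 'I_n, (i.+1 < n)%N -> asplund (X i))
    (G : set (maxprod X)) (G_open : open G) (f : maxprod X -> R) :
  ({within G, continuous f} ->
     exists A : set (maxprod X),
       [/\ A `<=` G, first_category A
         & forall x, (G `\` A) x ->
             (forall i, partial_differentiable f x i) -> differentiable f x])
  /\
  ([lipschitz f x | x in G] ->
     exists A : set (maxprod X),
       [/\ A `<=` G, sigma_porous A
         & forall x, (G `\` A) x ->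
             (forall i, partial_differentiable f x i) -> differentiable f x]).
Proof.
have ln : (n.-1 < n)%N by rewrite ltn_predL.
pose l := Ordinal ln.
have lP (i : 'I_n) : i != l -> (i.+1 < n)%N.
  rewrite -val_eqE /= ltn_neqAle ltn_ord andbT => il.
  by apply: contra il => /eqP e; rewrite -[X in X.-1]e.
pose S (c : 'I_n * nat * nat) :=
  slope_set (@coord_inj R n X c.1.1) G f c.1.2 c.2.+1%:R^-1.
split=> [|f_lip].
  rewrite continuous_open_subspace// => fc.
  (* Nothing is removed for the last coordinate, whose space need not be Asplund. *)
  pose B (c : 'I_n * nat * nat) := if (c.1.1.+1 < n)%N then
    S c `\` uniform_slope (@coord_inj R n X c.1.1) f (4 * c.2.+1%:R^-1)
    else set0.
  exists (\bigcup_c B c); split.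
  - move=> x [c _]; rewrite /B; case: ifP => // _ [+ _].
    exact: slope_set_subset.
  - apply: first_category_bigcup => c; rewrite /B; case: ifPn => [ci|_].
      apply: unstable_nowhere_dense => //.
      + exact: norm_coord_inj.
      + exact: X_asplund.
      + by move=> z Gz; apply: fc; rewrite inE.
    exact: nowhere_dense0.
  - move=> x [Gx Ax] fx.
    pose p i := projT1 (cid2 (partial_slope (fx i))).
    have pP i := projT2 (cid2 (partial_slope (fx i))).
    apply: (@stable_partial_differentiable _ _ _ f x l p).
    + by move=> i; have [] := pP i.
    + by have [] := pP l.
    + move=> i /lP il; have [[M pM] px] := pP i.
      apply: (continuous_stable_slope G_open Gx pM px) => m j xS.
      apply: contrapT => nx; apply: Ax; exists (i, m, j) => //.
      by rewrite /B /= il.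
have [L L0 fL] : exists2 L : R, 0 <= L &
    forall y z, G y -> G z -> `|f y - f z| <= L * `|y - z|.
  (* Every constant above [M] is a Lipschitz constant; this one is also nonnegative. *)
  have [M [_ HM]] := f_lip; exists (`|M| + 1); first by rewrite addr_ge0.
  move=> y z Gy Gz.
  by have /(_ (y, z)) := HM (`|M| + 1) (ltr_pwDr ltr01 (ler_norm M)); apply.
exists (\bigcup_c [set x | S c x /\ porous_at (S c) x]); split.
- by move=> x [c _ [+ _]]; exact: slope_set_subset.
- by apply: sigma_porous_bigcup => c; exact: porous_at_points.
- move=> x [Gx Ax] fx.
  pose p i := projT1 (cid2 (partial_slope (fx i))).
  have pP i := projT2 (cid2 (partial_slope (fx i))).
  apply: (@stable_partial_differentiable _ _ _ f x l p).
  + by move=> i; have [] := pP i.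
  + by have [] := pP l.
  + move=> i _; have [[M pM] px] := pP i.
    apply: (lipschitz_stable_slope _ L0 fL G_open Gx pM px) => [|m j xS xp].
      exact: norm_coord_inj.
    by apply: Ax; exists (i, m, j).
Qed.
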